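(* Let $G$ be a bipartite simple graph with $n$ vertices and with a vertex weight $\omega$. Then $$\max\big\{n\,\mathrm{MD}_\omega(G),\,E(G)\big\}\leq LE_\omega(G)\leq n\,\mathrm{MD}_\omega(G)+E(G).$$
   Context: Graphs are finite, simple, with nonempty vertex set $V(G)=\{v_1,\ldots,v_n\}$. A vertex weight $\omega$ of $G$ is a function from $V(G)$ to the set of positive real numbers. Write $\overline{\omega}=\frac1n\sum_{i=1}^n\omega(v_i)$. $A(G)$ denotes the $(0,1)$ adjacency matrix of $G$, and $D_\omega(G)=\mathrm{diag}(\omega(v_1),\ldots,\omega(v_n))$. The weighted Laplacian matrix is $L_\omega(G)=D_\omega(G)-A(G)$. The energy of $G$ is $E(G)=\sum_{i=1}^n|\lambda_i|$, where $\lambda_1,\ldots,\lambda_n$ are the eigenvalues of $A(G)$ (with multiplicity). The weighted Laplacian energy is $LE_\omega(G)=\sum_{i=1}^n|\mu_i-\overline{\omega}|$, where $\mu_1,\ldots,\mu_n$ are the eigenvalues of $L_\omega(G)$ (with multiplicity). The mean deviation of $G$ with respect to $\omega$ is $\mathrm{MD}_\omega(G)=\frac1n\sum_{i=1}^n|\omega(v_i)-\overline{\omega}|$. *)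

(* Defs.v *)
From HB Require Import structures.
From mathcomp Require Import all_boot all_order all_algebra.
From mathcomp Require Import polyrcf complex.
From mathcomp Require Import reals.

Set Implicit Arguments.
Unset Strict Implicit.
Unset Printing Implicit Defensive.

Import Order.TTheory GRing.Theory Num.Theory.
Local Open Scope ring_scope.

Lemma mup_prod_XsubC (R : rcfType) (s : seq R) (x : R) :
  mup x (\prod_(y <- s) ('X - y%:P)) = count_mem x s.
Proof.
elim: s => [|y s IHs].
  by rewrite big_nil mupNroot // /root hornerC oner_eq0.
rewrite big_cons mupM ?polyXsubC_eq0 ?monic_neq0 ?monicXsubC ?monic_prod_XsubC //.
rewrite IHs /= -['X - y%:P]expr1 mup_XsubCX.
by rewrite eq_sym; case: eqP.
Qed.

Lemma perm_roots_mup (R : rcfType) (p : {poly R}) (s : seq R) :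
  p = \prod_(y <- s) ('X - y%:P) ->
  perm_eq (flatten [seq nseq (mup x p) x | x <- rootsR p]) s.
Proof.
move=> pE; apply/allP => x _ /=; apply/eqP.
have p0 : p != 0 by rewrite pE monic_neq0 ?monic_prod_XsubC.
have rootsE y : (y \in rootsR p) = (y \in s).
  rewrite -[RHS]root_prod_XsubC -pE.
  by have := roots_on_rootsR p0 y; rewrite itv_boundlr /= => ->.
rewrite count_flatten -map_comp sumnE big_map.
under eq_bigr => y _ do rewrite /= count_nseq /=.
have [xs|xNs] := boolP (x \in s).
- have xr : x \in rootsR p by rewrite rootsE.
  rewrite (big_rem x) //= eqxx mul1n {1}pE mup_prod_XsubC.
  rewrite big1_seq ?addn0 // => y; rewrite /= mem_rem_uniq ?inE ?uniq_roots //.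
  by case/andP => /negPf->.
- rewrite (count_memPn xNs) big1_seq // => y /=; rewrite rootsE.
  by case: eqP xNs => [->/negPf->|].
Qed.

(* The roots in [R] of the characteristic polynomial, each repeated according to
   its multiplicity.  Roots outside [R] are dropped, but for a symmetric matrix
   there are none: see [char_poly_eigenvalues] and [size_eigenvalues]. *)
Definition eigenvalues (R : rcfType) (n : nat) (A : 'M[R]_n) : seq R :=
  flatten [seq nseq (mup x (char_poly A)) x | x <- rootsR (char_poly A)].

Lemma char_poly_eigenvalues (R : rcfType) (n : nat) (A : 'M[R]_n) :
  A^T = A -> char_poly A = \prod_(x <- eigenvalues A) ('X - x%:P).
Proof.
move=> symA; pose f := real_complex R.
suff [s pE] : exists s : seq R, char_poly A = \prod_(x <- s) ('X - x%:P).
  by rewrite [LHS]pE; apply/esym/perm_big/perm_roots_mup.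
have real_f (x : R) : f x \is Num.real by apply/complex_realP; exists x.
pose B := map_mx f A.
have hB : B \is hermsymmx.
  apply: realsym_hermsym.
    by apply/is_hermitianmxP; rewrite expr0 scale1r map_mx_id // /B map_trmx symA.
  by apply/mxOverP => i j; rewrite mxE real_f.
have /orthomx_spectralP BE := hermitian_normalmx hB.
set P := spectralmx B in BE; set d := spectral_diag B in BE.
have Pu : P \in unitmx := spectral_unit B.
have dr i : d 0 i = f (complex.Re (d 0 i)).
  have /mxOverP/(_ 0 i) := hermitian_spectral_diag_real hB.
  by case/complex_realP => x ->.
exists [seq complex.Re (d 0 i) | i <- enum 'I_n].
apply: (map_poly_inj f).
rewrite map_char_poly -/B rmorph_prod big_map big_enum /=.
transitivity (char_poly (diag_mx d)).
  pose Q := map_mx polyC P; pose Qi := map_mx polyC (invmx P).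
  have QiQ : Qi *m Q = 1%:M by rewrite -map_mxM mulVmx // map_mx1.
  have -> : char_poly B = \det (Qi *m char_poly_mx (diag_mx d) *m Q).
    rewrite /char_poly /char_poly_mx mulmxBr mulmxBl {1}BE !map_mxM.
    by rewrite mul_mx_scalar -scalemxAl QiQ scalemx1.
  by rewrite !det_mulmx mulrAC -det_mulmx QiQ det1 mul1r.
rewrite char_poly_trig ?diag_mx_is_trig //.
by apply: eq_bigr => i _; rewrite map_polyXsubC mxE eqxx mulr1n [in LHS]dr.
Qed.

Lemma size_eigenvalues (R : rcfType) (n : nat) (A : 'M[R]_n) :
  A^T = A -> size (eigenvalues A) = n.
Proof.
move=> /char_poly_eigenvalues pE; apply: succn_inj.
by rewrite -(size_prod_XsubC _ id) -pE size_char_poly.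
Qed.

Record sgraph := SGraph {
  vertex :> finType;
  adj : rel vertex;
  adj_sym : symmetric adj;
  adj_irrefl : irreflexive adj;
  vertex_gt0 : (0 < #|vertex|)%N }.

Definition bipartite (G : sgraph) : Prop :=
  exists X : {set G}, forall u v : G, adj u v -> (u \in X) != (v \in X).

Definition is_vweight (R : realType) (G : sgraph) (w : G -> R) : Prop :=
  forall v, 0 < w v.

(* The vertices are numbered by [enum_val]; the spectra below do not depend on
   the numbering. *)
Definition adj_mx (R : realType) (G : sgraph) : 'M[R]_#|G| :=
  \matrix_(i, j) (adj (enum_val i) (enum_val j))%:R.

Definition weight_mx (R : realType) (G : sgraph) (w : G -> R) : 'M[R]_#|G| :=
  diag_mx (\row_i w (enum_val i)).

Definition wlaplacian (R : realType) (G : sgraph) (w : G -> R) : 'M[R]_#|G| :=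
  weight_mx w - adj_mx R G.

Definition mean_weight (R : realType) (G : sgraph) (w : G -> R) : R :=
  #|G|%:R^-1 * \sum_(v : G) w v.

Definition mean_deviation (R : realType) (G : sgraph) (w : G -> R) : R :=
  #|G|%:R^-1 * \sum_(v : G) `|w v - mean_weight w|.

Definition energy (R : realType) (G : sgraph) : R :=
  \sum_(x <- eigenvalues (adj_mx R G)) `|x|.

Definition wlaplacian_energy (R : realType) (G : sgraph) (w : G -> R) : R :=
  \sum_(x <- eigenvalues (wlaplacian w)) `|x - mean_weight w|.

Lemma adj_mx_sym (R : realType) (G : sgraph) : (adj_mx R G)^T = adj_mx R G.
Proof. by apply/matrixP => i j; rewrite !mxE adj_sym. Qed.

Lemma wlaplacian_sym (R : realType) (G : sgraph) (w : G -> R) :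
  (wlaplacian w)^T = wlaplacian w.
Proof. by rewrite /wlaplacian linearB /= tr_diag_mx adj_mx_sym. Qed.

(* Main.v *)
Require Import Defs.
From mathcomp Require Import all_boot all_order all_algebra.
From mathcomp Require Import complex.
From mathcomp Require Import reals.
Import Order.TTheory GRing.Theory Num.Theory.
Local Open Scope ring_scope.

Set Implicit Arguments.
Unset Strict Implicit.

(** For a real symmetric matrix [M], let [N M] be the sum of the absolute values
    of its eigenvalues (its trace norm).  With [c] the mean weight and
    [D = diag (w_i - c)], one has [LE = N (D - A)], [E = N A] and
    [n MD = N D], so the upper bound is the triangle inequality for [N].

    If [G] is bipartite with part [X], the signature matrix [S], with entries
    [-1] on [X] and [1] off [X], satisfies [S A S = - A] and [S D S = D].  Hence
    [D + A = S (D - A) S] has the same trace norm as [D - A], and the lower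
    bounds follow from [2 D = (D - A) + (D + A)] and
    [- 2 A = (D - A) - (D + A)].

    The triangle inequality is proved by duality: if [A + B] is diagonalized by
    the unitary matrix [Q] with eigenvalues [c_k], then
    [V = Q^* diag (sg c_k) Q] gives [N (A + B) = tr ((A + B) V)], while
    [norm_mxtrace_unitary_diag] bounds [tr (A V)] by [N A] and [tr (B V)] by
    [N B].  All spectra are computed from unitary diagonalizations over [R[i]],
    which by [perm_eigenvalues] exhibit the eigenvalues with multiplicity. *)

Local Open Scope sesquilinear_scope.

Local Notation toC := (real_complex _).

(** * A trace bound for unitarily diagonalized matrices *)

Lemma sum_sqr_norm_row_unitary (C : numClosedFieldType) n (U : 'M[C]_n) i :
  U \is unitarymx -> \sum_j `|U i j| ^+ 2 = 1.
Proof.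
move=> /unitarymxP/matrixP/(_ i i); rewrite !mxE eqxx => /= UE.
apply: etrans UE.
by apply: eq_bigr => j _; rewrite !mxE normCK.
Qed.

(** After cyclic permutation the trace is
    [\sum_i \sum_j d_i e_j |U_ij|^2] with [U = P Q^*] unitary, and the squared
    norms in a row of [U] sum to 1. *)
Lemma norm_mxtrace_unitary_diag (C : numClosedFieldType) n
    (P Q : 'M[C]_n) (d e : 'rV[C]_n) :
    P \is unitarymx -> Q \is unitarymx -> (forall j, `|e 0 j| <= 1) ->
  `|\tr ((P^t* *m diag_mx d *m P) *m (Q^t* *m diag_mx e *m Q))|
    <= \sum_i `|d 0 i|.
Proof.
move=> Pu Qu e1; pose U := P *m Q^t*.
have Uu : U \is unitarymx by rewrite mul_unitarymx ?trmxC_unitary.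
have -> : \tr ((P^t* *m diag_mx d *m P) *m (Q^t* *m diag_mx e *m Q))
    = \tr (diag_mx d *m (U *m diag_mx e *m U^t*)).
  rewrite /U trmx_mul map_mxM /= trmxCK -!mulmxA mxtrace_mulC.
  by rewrite -!mulmxA.
move: U Uu => U Uu; rewrite mul_diag_mx mul_mx_diag.
apply: le_trans (ler_norm_sum _ _ _) _.
apply: ler_sum => i _; rewrite !mxE normrM -[leRHS]mulr1.
apply: ler_wpM2l => //; rewrite -(sum_sqr_norm_row_unitary i Uu).
apply: le_trans (ler_norm_sum _ _ _) _; apply: ler_sum => j _.
rewrite ![in leLHS]mxE !normrM norm_conjC mulrAC -expr2.
by rewrite ler_piMr ?exprn_ge0.
Qed.

(** * Spectra of real symmetric matrices *)

(** The unitary matrix [P], with entries in [R[i]], diagonalizes the real matrix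
    [A], the diagonal being the real vector [d]. *)
Definition unitary_diagonalizes (R : rcfType) n
    (A : 'M[R]_n) (P : 'M[R[i]]_n) (d : 'rV[R]_n) : Prop :=
  P \is unitarymx /\
  map_mx toC A = P^t* *m diag_mx (map_mx toC d) *m P.

Lemma symmetric_unitary_diagonalizes (R : rcfType) n (A : 'M[R]_n) :
  A^T = A -> exists P d, unitary_diagonalizes A P d.
Proof.
move=> symA; set B := map_mx toC A.
have hB : B \is hermsymmx.
  apply: realsym_hermsym.
    by apply/is_hermitianmxP; rewrite expr0 scale1r map_mx_id // map_trmx symA.
  by apply/mxOverP => i j; rewrite mxE; apply/complex_realP; eexists.
have /orthomx_spectralP BE := hermitian_normalmx hB.
exists (spectralmx B), (map_mx (@complex.Re R) (spectral_diag B)).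
split; first exact: spectral_unitarymx.
apply: (etrans BE); rewrite invmx_unitary; last exact: spectral_unitarymx.
congr (_ *m diag_mx _ *m _); apply/rowP => i; rewrite 2![in RHS]mxE.
have /mxOverP/(_ 0 i) := hermitian_spectral_diag_real hB.
by case/complex_realP => x ->.
Qed.

Lemma perm_eigenvalues (R : rcfType) n (A : 'M[R]_n) P d :
  unitary_diagonalizes A P d ->
  perm_eq (eigenvalues A) [seq d 0 i | i <- enum 'I_n].
Proof.
case=> Pu AE; apply: perm_roots_mup; apply: (map_poly_inj toC).
rewrite map_char_poly AE rmorph_prod big_map big_enum /=.
set D := diag_mx _; transitivity (char_poly D).
  pose Q := map_mx polyC P; pose Qi := map_mx polyC (P^t*).
  have QiQ : Qi *m Q = 1%:M.
    by rewrite -map_mxM -invmx_unitary // mulVmx ?unitarymx_unit // map_mx1.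
  have -> : char_poly (P^t* *m D *m P) = \det (Qi *m char_poly_mx D *m Q).
    rewrite /char_poly /char_poly_mx mulmxBr mulmxBl !map_mxM.
    by rewrite mul_mx_scalar -scalemxAl QiQ scalemx1.
  by rewrite !det_mulmx mulrAC -det_mulmx QiQ det1 mul1r.
rewrite char_poly_trig ?diag_mx_is_trig //.
by apply: eq_bigr => i _; rewrite map_polyXsubC !mxE eqxx mulr1n.
Qed.

Lemma sum_eigenvalues (R : rcfType) n (A : 'M[R]_n) P d (F : R -> R) :
  unitary_diagonalizes A P d ->
  \sum_(x <- eigenvalues A) F x = \sum_i F (d 0 i).
Proof.
by move=> /perm_eigenvalues/(perm_big _)->; rewrite big_map big_enum.
Qed.

(** * The trace norm *)

(** The trace norm of a real symmetric matrix: the sum of the absolute values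
    of its eigenvalues. *)
Definition trace_norm (R : rcfType) n (A : 'M[R]_n) : R :=
  \sum_(x <- eigenvalues A) `|x|.

Lemma trace_norm_triangle (R : rcfType) n (A B : 'M[R]_n) :
  A^T = A -> B^T = B ->
  trace_norm (A + B) <= trace_norm A + trace_norm B.
Proof.
move=> symA symB.
have symAB : (A + B)^T = A + B by rewrite linearD /= symA symB.
have [PA [a ha]] := symmetric_unitary_diagonalizes symA.
have [PB [b hb]] := symmetric_unitary_diagonalizes symB.
have [Q [c hc]] := symmetric_unitary_diagonalizes symAB.
rewrite /trace_norm (sum_eigenvalues _ ha).
rewrite (sum_eigenvalues _ hb) (sum_eigenvalues _ hc).
case: ha hb hc => PAu AE [PBu BE] [Qu CE].
have norm_f x : `|toC x| = toC `|x|.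
  by rewrite normc_def /= expr0n addr0 sqrtr_sqr.
(* [e] lists the signs of the eigenvalues of [A + B], so that the matrix [V]
   below satisfies [(A + B) V = |A + B|]. *)
pose e := map_mx toC (map_mx Num.sg c).
have e1 j : `|e 0 j| <= 1.
  by rewrite !mxE norm_f -(rmorph1 toC) lecR normr_sg lern1 leq_b1.
pose V := Q^t* *m diag_mx e *m Q.
have trV : \tr (map_mx toC (A + B) *m V) = toC (\sum_i `|c 0 i|).
  rewrite CE /V mxtrace_mulC -!mulmxA [Q *m (Q^t* *m _)]mulmxA.
  rewrite (unitarymxP Qu) mul1mx mxtrace_mulC -!mulmxA (unitarymxP Qu) mulmx1.
  rewrite mulmx_diag mxtrace_diag rmorph_sum; apply: eq_bigr => i _.
  by rewrite !mxE -rmorphM normrEsg.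
have := norm_mxtrace_unitary_diag (map_mx toC a) PAu Qu e1.
have := norm_mxtrace_unitary_diag (map_mx toC b) PBu Qu e1.
rewrite -/V -AE -BE => hB hA.
rewrite -lecR -[leLHS]ger0_norm; last first.
  by rewrite -(rmorph0 toC) lecR sumr_ge0.
rewrite -trV map_mxD mulmxDl mxtraceD; apply: le_trans (ler_normD _ _) _.
rewrite rmorphD !rmorph_sum; apply: lerD.
  apply: le_trans hA _.
  by apply: ler_sum => i _; rewrite mxE norm_f.
apply: le_trans hB _.
by apply: ler_sum => i _; rewrite mxE norm_f.
Qed.

Lemma trace_normZ (R : rcfType) n (k : R) (A : 'M[R]_n) :
  A^T = A -> trace_norm (k *: A) = `|k| * trace_norm A.
Proof.
move=> /symmetric_unitary_diagonalizes [P [d hd]].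
have hkd : unitary_diagonalizes (k *: A) P (k *: d).
  case: hd => Pu AE; split; first exact: Pu.
  have diagZ (c : R[i]) (u : 'rV_n) : diag_mx (c *: u) = c *: diag_mx u.
    by apply/matrixP => i j; rewrite !mxE mulrnAr.
  by rewrite map_mxZ AE map_mxZ diagZ -scalemxAr -scalemxAl.
rewrite /trace_norm (sum_eigenvalues _ hd).
rewrite (sum_eigenvalues _ hkd) mulr_sumr.
by apply: eq_bigr => i _; rewrite mxE normrM.
Qed.

Lemma trace_norm_diag (R : rcfType) n (d : 'rV[R]_n) :
  trace_norm (diag_mx d) = \sum_i `|d 0 i|.
Proof.
apply: (sum_eigenvalues (P := 1%:M)); split.
  by apply/unitarymxP; rewrite trmx1 map_mx1 mulmx1.
by rewrite map_diag_mx trmx1 map_mx1 mul1mx mulmx1.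
Qed.

(** Subtracting a scalar matrix shifts the spectrum. *)
Lemma trace_norm_sub_scalar (R : rcfType) n (A : 'M[R]_n) (c : R) :
  A^T = A -> trace_norm (A - c%:M) = \sum_(x <- eigenvalues A) `|x - c|.
Proof.
move=> /symmetric_unitary_diagonalizes [P [d hd]].
have hdc : unitary_diagonalizes (A - c%:M) P (d - const_mx c).
  case: hd => Pu AE; split; first exact: Pu.
  rewrite !map_mxB AE linearB /= mulmxBr mulmxBl; congr (_ - _).
  rewrite map_scalar_mx map_const_mx diag_const_mx /=.
  rewrite mul_mx_scalar -scalemxAl -invmx_unitary //.
  by rewrite mulVmx ?unitarymx_unit // scalemx1.
rewrite (sum_eigenvalues (fun x => `|x - c|) hd).
rewrite /trace_norm (sum_eigenvalues _ hdc).
by apply: eq_bigr => i _; rewrite !mxE.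
Qed.

(** The trace norm is invariant under conjugation by a signature matrix. *)
Lemma trace_norm_signature (R : rcfType) n (A : 'M[R]_n) (s : 'rV[R]_n) :
    A^T = A -> (forall i, s 0 i * s 0 i = 1) ->
  trace_norm (diag_mx s *m A *m diag_mx s) = trace_norm A.
Proof.
move=> /symmetric_unitary_diagonalizes [P [d hd]] s1.
pose S := diag_mx (map_mx toC s).
have SE : S^t* = S.
  rewrite tr_diag_mx map_diag_mx; congr diag_mx.
  apply/rowP => i; rewrite !mxE; apply: conj_Creal.
  by apply/complex_realP; eexists.
have SS : S *m S = 1%:M.
  apply/matrixP => i j; rewrite mulmx_diag !mxE -rmorphM s1 rmorph1.
  by case: eqP.
have hs : unitary_diagonalizes (diag_mx s *m A *m diag_mx s) (P *m S) d.
  case: hd => Pu AE; split.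
    by apply: (mul_unitarymx Pu); apply/unitarymxP; rewrite SE; exact: SS.
  by rewrite !map_mxM AE !map_diag_mx trmx_mul map_mxM /= SE !mulmxA.
rewrite /trace_norm (sum_eigenvalues _ hd).
by rewrite (sum_eigenvalues _ hs).
Qed.

(** * Energies of weighted graphs *)

(** The diagonal of the centered weight matrix. *)
Definition centered_weight (R : realType) (G : sgraph) (w : G -> R) :
    'rV[R]_#|G| :=
  \row_i (w (enum_val i) - mean_weight w).

Lemma trace_norm_centered_weight (R : realType) (G : sgraph) (w : G -> R) :
  trace_norm (diag_mx (centered_weight w))
    = #|G|%:R * mean_deviation w.
Proof.
rewrite trace_norm_diag mulrA mulfV ?mul1r; last first.
  by rewrite pnatr_eq0 -lt0n vertex_gt0.
rewrite [RHS](reindex_onto enum_val enum_rank) => [|v _]; last first.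
  exact: enum_rankK.
apply: eq_big => [i|i _]; last by rewrite mxE.
by rewrite enum_valK eqxx.
Qed.

Lemma wlaplacian_energy_trace_norm (R : realType) (G : sgraph) (w : G -> R) :
  wlaplacian_energy w
    = trace_norm (diag_mx (centered_weight w) - adj_mx R G).
Proof.
have LE : wlaplacian w - (mean_weight w)%:M
    = diag_mx (centered_weight w) - adj_mx R G.
  rewrite /wlaplacian addrAC; congr (_ - _).
  by apply/matrixP => i j; rewrite !mxE -mulrnBl.
rewrite -LE; exact: esym (trace_norm_sub_scalar _ (wlaplacian_sym w)).
Qed.

(** Flipping the signs on one side of the bipartition turns [D - A] into
    [D + A]. *)
Lemma trace_norm_bipartite (R : realType) (G : sgraph) (d : 'rV[R]_#|G|) :
    bipartite G ->
  trace_norm (diag_mx d + adj_mx R G)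
    = trace_norm (diag_mx d - adj_mx R G).
Proof.
case=> X hX; pose s : 'rV[R]_#|G| := \row_i (-1) ^+ (enum_val i \in X).
have s1 i : s 0 i * s 0 i = 1 by rewrite mxE -expr2 sqrr_sign.
have symDA : (diag_mx d - adj_mx R G)^T = diag_mx d - adj_mx R G.
  by rewrite linearB /= tr_diag_mx adj_mx_sym.
apply: etrans (trace_norm_signature symDA s1).
congr trace_norm; rewrite mulmxBr mulmxBl; congr (_ + _).
  rewrite !mulmx_diag; congr diag_mx; apply/rowP => i.
  by rewrite !mxE mulrAC -expr2 sqrr_sign mul1r.
apply/matrixP => i j; rewrite mul_diag_mx mul_mx_diag !mxE.
case: (boolP (adj _ _)) => [/hX|_]; last by rewrite mulr0 mul0r oppr0.
by case: (_ \in X); case: (_ \in X) => // _;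
  rewrite !(expr0, expr1, mulr1, mul1r, opprK).
Qed.

Local Close Scope sesquilinear_scope.
Unset Implicit Arguments.
Set Strict Implicit.

Theorem theorem5 (R : realType) (G : sgraph) (w : G -> R)
    (hG : bipartite G) (hw : is_vweight w) :
  Num.max (#|G|%:R * mean_deviation w) (energy R G) <= wlaplacian_energy w
  /\ wlaplacian_energy w <= #|G|%:R * mean_deviation w + energy R G.
Proof.
rewrite wlaplacian_energy_trace_norm -trace_norm_centered_weight.
have -> : energy R G = trace_norm (adj_mx R G) by [].
set d := centered_weight w; set A := adj_mx R G.
have symA : A^T = A by exact: adj_mx_sym.
have symD : (diag_mx d)^T = diag_mx d by exact: tr_diag_mx.
have symDA : (diag_mx d - A)^T = diag_mx d - A by rewrite linearB /= symD symA.
have symDpA : (diag_mx d + A)^T = diag_mx d + A.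
  by rewrite linearD /= symD symA.
have normDpA := trace_norm_bipartite d hG; rewrite -/A in normDpA.
have symN n (B : 'M[R]_n) : B^T = B -> (- B)^T = - B.
  by rewrite linearN /= => ->.
have normN n (B : 'M[R]_n) : B^T = B -> trace_norm (- B) = trace_norm B.
  by move=> symB; rewrite -scaleN1r (trace_normZ _ symB) normrN1 mul1r.
split; last first.
  by rewrite -(normN _ A symA); apply: trace_norm_triangle symD (symN _ _ symA).
have norm2 n (B : 'M[R]_n) : B^T = B -> trace_norm (B + B) = trace_norm B *+ 2.
  move=> symB; rewrite -mulr2n -scaler_nat (trace_normZ _ symB) normr_nat.
  by rewrite mulr_natl.
have half (x y : R) : x *+ 2 <= y + y -> x <= y by rewrite -mulr2n ler_pMn2r.
rewrite ge_max; apply/andP; split; apply: half.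
  have := trace_norm_triangle symDA symDpA.
  by rewrite normDpA addrACA addNr addr0 (norm2 _ _ symD).
have := trace_norm_triangle symDA (symN _ _ symDpA).
rewrite (normN _ _ symDpA) normDpA opprD addrACA subrr add0r.
by rewrite (norm2 _ _ (symN _ _ symA)) (normN _ _ symA).
Qed.
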